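(* Let $X$ be a finite index set, $K\subset X$, let $M\in\mathbb{R}^{X\times X}$ be symmetric, and let $H\in\mathbb{C}^{K\times K}$ be a normal matrix that has $|K|$ distinct eigenvalues and an orthonormal eigenbasis $v_1,\dots,v_{|K|}$. Assume that $K$ is $H$-cospectral in $M$. Let $\mathcal{F}\ge\mathbb{Q}$ denote the smallest number field containing all entries of $M$ and all roots of the characteristic polynomial of $H$; then $v_1,\dots,v_{|K|}\in\mathcal{F}^{|K|}$. Let $Q\in\mathbb{R}$ be a transcendental number that is algebraically independent of $\mathcal{F}$, let $M^K=M+Q\cdot D_K$, and for $1\le j\le|K|$ let $P_j$ be the minimal polynomial of $M^K$ relative to $\hat v_j$. Then $P_j$ is irreducible in $\mathcal{F}[Q,t]$ (and hence also in $\mathcal{F}(Q)[t]$) for all $j\ge1$.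
   Context: $D_K$ is the $X\times X$ diagonal matrix with diagonal entries $1$ in $K$ and $0$ outside $K$. For $v\in\mathbb{C}^K$, $\hat v\in\mathbb{C}^X$ is its extension by $0$ to the other coordinates of $X$; for $v\in\mathbb{C}^X$, $\tilde v\in\mathbb{C}^K$ is its restriction to $K$. $K$ is $H$-cospectral in $M$ if there is an orthonormal (with respect to the Hermitian scalar product) basis $\psi_1,\dots,\psi_{|X|}$ of $\mathbb{C}^X$ consisting of eigenvectors of $M$ such that each $\tilde{\psi_j}$ is either $0$ or an eigenvector of $H$. The minimal polynomial of a matrix $A$ relative to a vector $w$ is the monic polynomial $p(t)$ of smallest degree with $p(A)w=0$. For $1\le j\le|K|$ one has $P_j\in\mathcal{F}[Q,t]$, with $Q$ playing the role of a variable.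
   Formalization: The entries of H are additionally assumed to lie in F (otherwise P_j need not lie in F[Q,t]), and ''v_j in F^|K|'' is claimed only up to a nonzero scalar multiple, since unit eigenvectors such as (1,1)/√2 need not have entries in F. *)

(* Defs.v *)
From HB Require Import structures.
From mathcomp Require Import all_boot all_order all_algebra.
From mathcomp Require Import boolp classical_sets reals complex.

Set Implicit Arguments.
Unset Strict Implicit.
Unset Printing Implicit Defensive.

Import Order.TTheory GRing.Theory Num.Theory.
Local Open Scope ring_scope.
Local Open Scope sesquilinear_scope.

Section GeneratedSubfield.
Variables (L : fieldType) (A : set L).

Definition gen_subfield : {pred L} :=
  fun x => `[< forall S : {pred L}, divring_closed S ->
                 (forall a, A a -> a \in S) -> x \in S >].

Fact gen_subfield_divring : divring_closed gen_subfield.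
Proof.
split; first by apply/asboolP => S [].
- move=> x y /asboolP xF /asboolP yF; apply/asboolP => S SD AS.
  by case: (SD) => _ SB _; apply: SB; [apply: xF | apply: yF].
- move=> x y /asboolP xF /asboolP yF; apply/asboolP => S SD AS.
  by case: (SD) => _ _ SV; apply: SV; [apply: xF | apply: yF].
Qed.

HB.instance Definition _ :=
  GRing.isDivringClosed.Build L gen_subfield gen_subfield_divring.

(* The same subfield as a fieldType; [val] is its inclusion in [L]. *)
Definition gen_subfield_type : Type := {x : L | x \in gen_subfield}.

HB.instance Definition _ := SubChoice.on gen_subfield_type.
HB.instance Definition _ :=
  [SubChoice_isSubIntegralDomain of gen_subfield_type by <:].
HB.instance Definition _ :=
  [SubIntegralDomain_isSubField of gen_subfield_type by <:].

End GeneratedSubfield.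

Definition irreducible_elem (D : idomainType) (p : D) : Prop :=
  [/\ p != 0, p \isn't a GRing.unit
    & forall a b : D, p = a * b -> a \is a GRing.unit \/ b \is a GRing.unit].

Section LinearAlgebra.
Variable C : numClosedFieldType.

Definition eigenvector n (A : 'M[C]_n) (w : 'cV[C]_n) : Prop :=
  w != 0 /\ exists a : C, A *m w = a *: w.

Definition all_eigenvalues_distinct n (A : 'M[C]_n) : Prop :=
  exists theta : 'I_n -> C,
    injective theta /\ forall i, eigenvalue A (theta i).

(* Being n vectors of C^n, such a family is automatically a basis. *)
Definition orthonormal_basis n (w : 'I_n -> 'cV[C]_n) : Prop :=
  forall i j, ((w j) ^t* *m w i) 0 0 = (i == j)%:R.

Definition mx_poly_apply n (A : 'M[C]_n) (p : {poly C}) (w : 'cV[C]_n) :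
  'cV[C]_n := \sum_(i < size p) p`_i *: (A ^+ i *m w).

Definition relative_minpoly n (A : 'M[C]_n) (w : 'cV[C]_n) (p : {poly C}) :
  Prop :=
  [/\ p \is monic, mx_poly_apply A p w = 0
    & forall q : {poly C}, q \is monic -> mx_poly_apply A q w = 0 ->
        (size p <= size q)%N].

Variables (n : nat) (K : {set 'I_n}).

(* Coordinates in K are numbered by 'I_#|K| through [enum_val]. *)
Definition extend0 (w : 'cV[C]_#|K|) : 'cV[C]_n :=
  \col_x \sum_(i < #|K| | enum_val i == x) w i 0.

Definition restrictK (w : 'cV[C]_n) : 'cV[C]_#|K| :=
  \col_i w (enum_val i) 0.

Definition diagK : 'M[C]_n := diag_mx (\row_x (x \in K)%:R).

Definition cospectral (H : 'M[C]_#|K|) (M : 'M[C]_n) : Prop :=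
  exists psi : 'I_n -> 'cV[C]_n,
    [/\ orthonormal_basis psi, forall j, eigenvector M (psi j)
      & forall j, restrictK (psi j) = 0 \/ eigenvector H (restrictK (psi j))].

End LinearAlgebra.

Arguments diagK {C n} K.

Section CoefficientField.
Variables (R : realType) (n k : nat) (M : 'M[R]_n) (H : 'M[R[i]]_k).

Definition complexify : 'M[R[i]]_n := map_mx (real_complex R) M.

(* M is an arbitrary real matrix, so the field F generated by these elements
   need not be algebraic over the rationals. *)
Definition coef_gens : set R[i] :=
  [set z | (exists x y, z = complexify x y) \/ root (char_poly H) z].

Definition coef_subfield : {pred R[i]} := gen_subfield coef_gens.

Definition coef_field : fieldType := gen_subfield_type coef_gens.

Definition coef_incl : coef_field -> R[i] := val.

HB.instance Definition _ := GRing.RMorphism.on coef_incl.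

End CoefficientField.

(* F[Q,t] is represented by {poly {poly F}}: the inner variable is Q, the outer
   one is t.  [eval_inner iota q P] is the polynomial in t over L obtained from
   P by substituting the number q for Q. *)
Definition eval_inner (F L : fieldType) (iota : F -> L) (q : L)
    (P : {poly {poly F}}) : {poly L} :=
  map_poly (fun c : {poly F} => (map_poly iota c).[q]) P.

(* Main.v *)
Require Import Defs.
From HB Require Import structures.
From mathcomp Require Import all_boot all_order all_algebra ring.
From mathcomp Require Import boolp classical_sets reals complex.

Set Implicit Arguments.
Unset Strict Implicit.
Unset Printing Implicit Defensive.

Import Order.TTheory GRing.Theory Num.Theory.
Local Open Scope ring_scope.
Local Open Scope sesquilinear_scope.

(** Fix [j], put [u := extend0 (v j)], a unit vector, and write [u^*] for its
    adjoint, [A] for the complexified matrix [M] and [B := A + Q *: diagK K].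

    Cospectrality makes [diagK K] act on the cyclic space of [u] under [A] as
    the rank one operator [u *m u^*] ([cospectral_rank1]): an eigenvector of
    [M] that is not orthogonal to [u] restricts to a multiple of [v j].
    For a rank one update, polynomials in [A] applied to [u] are converted into
    polynomials in [B] applied to [u] by an explicit rule
    ([mx_poly_apply_update]): [q] in [A] becomes [q - Q nu_q] in [B], where
    [nu_q(t) = u^* ((q(t) - q(A)) / (t - A)) u].
    The rule preserves degrees and leading coefficients and is onto, so it
    carries the minimal polynomial [mu] of [A] relative to [u] to that of [B]:
    [P j = mu - Q nu] with [nu := nu_mu]. This has degree one in [Q].

    A degree one polynomial [mu(t) - Q nu(t)] is irreducible as soon as [mu]
    and [nu] are coprime. Coprimality comes from positivity
    ([coprimep_diffquo]): if [mu = a g] and [g] divides [nu], then [mu] divides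
    [a nu], and this forces the functional [r |-> u^* r(A) u] to vanish on all
    multiples of [a] ([dvdp_mul_diffquo]). Taking for [r] the product of [a]
    and its conjugate gives [|a(A) u|^2 = 0] because [A] is Hermitian, so the
    minimality of [mu] makes [g] constant.

    For the irreducibility over F(Q) ([pencil_irreducible_frac]), a
    factor of [mu - Q nu] is made to vanish under the substitution
    [Q := mu / nu] in F(t); a nonzero element of F[Q,t] killed by it has degree
    at least [deg mu] in [t]. Since [mu - Q nu] is monic in [t],
    irreducibility in F[Q,t] follows ([monic_irreducible_frac]).

    It remains to see that [mu] and [nu] have coefficients in F
    ([minpoly_update_irreducible]). The eigenvalues of [H] lie in F, so [u] is
    proportional to a vector over F. Complex conjugation need not preserve F,
    but [u^*] extends the left eigenvector [(v j)^*] of [H], hence is also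
    proportional to a vector over F. Linear dependencies between the vectors
    [A^i u] descend to F, and so does [mu]
    ([relative_minpoly_descent]). *)

(** * Difference quotients of polynomials against a linear functional *)

Section DifferenceQuotient.
Variable E : fieldType.

(** The polynomial in t obtained by applying [L], in the variable x, to
    (q(t) - q(x)) / (t - x): the coefficient of t^b in that quotient is
    [drop_poly b.+1 q], evaluated at x. *)
Definition diffquo (L : {poly E} -> E) (q : {poly E}) : {poly E} :=
  \poly_(b < (size q).-1) L (drop_poly b.+1 q).

Definition shift_form (L : {scalar {poly E}}) (a q : {poly E}) : E := L (a * q).

Fact shift_form_is_scalar L a : scalar (shift_form L a).
Proof. by move=> k p q; rewrite /shift_form mulrDr -scalerAr linearP. Qed.

HB.instance Definition _ L a :=
  GRing.isLinear.Build E {poly E} E *%R (shift_form L a)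
    (shift_form_is_scalar L a).

Section Functional.
Variable L : {scalar {poly E}}.

Lemma coef_diffquo q b : (diffquo L q)`_b = L (drop_poly b.+1 q).
Proof.
rewrite coef_poly; case: ltnP => // le_b.
by rewrite drop_poly_eq0 ?linear0 //; move: le_b; case: (size q).
Qed.

Lemma size_diffquo q : (size (diffquo L q) <= (size q).-1)%N.
Proof. exact: size_poly. Qed.

Lemma size_diffquo_lt q : q != 0 -> (size (diffquo L q) < size q)%N.
Proof.
by rewrite -size_poly_gt0 => q_gt0; rewrite -(prednK q_gt0) ltnS size_diffquo.
Qed.

Fact diffquo_is_linear : linear (diffquo L).
Proof.
move=> k p q; apply/polyP => b.
by rewrite coefD coefZ !coef_diffquo linearP /= linearP.
Qed.

Lemma diffquoC c : diffquo L c%:P = 0.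
Proof.
apply/polyP => b; rewrite coef_diffquo coef0 drop_poly_eq0 ?linear0 //.
by rewrite (leq_trans (size_polyC_leq1 c)).
Qed.

Lemma diffquoMX q : diffquo L (q * 'X) = diffquo L q * 'X + (L q)%:P.
Proof.
apply/polyP => b; rewrite coefD coefMX coefC !coef_diffquo.
have -> : drop_poly b.+1 (q * 'X) = drop_poly b q.
  apply/polyP=> i; rewrite !coef_drop_poly coefMX addnS /=; by [].
by case: b => [|b] /=; rewrite ?add0r ?drop_poly0l ?addr0.
Qed.
End Functional.

HB.instance Definition _ (L : {scalar {poly E}}) :=
  GRing.isLinear.Build E {poly E} {poly E} *:%R (diffquo L)
    (diffquo_is_linear L).

(** Comes from the identity
    (pq)(t) - (pq)(x) = p(t) (q(t) - q(x)) + (p(t) - p(x)) q(x). *)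
Lemma diffquoM (L : {scalar {poly E}}) p q :
  diffquo L (p * q) = p * diffquo L q + diffquo (shift_form L q) p.
Proof.
elim/poly_ind: p => [|p c IHp]; first by rewrite !mul0r !linear0 addr0.
rewrite mulrDl mulrAC mul_polyC linearD /= diffquoMX IHp linearZ /=.
rewrite [in RHS]linearD /= diffquoC addr0 diffquoMX /= /shift_form.
rewrite [q * p]mulrC -mul_polyC.
by ring.
Qed.
End DifferenceQuotient.

Section Coprimality.
Variables (E : fieldType) (mu : {poly E}).
Hypothesis mu_neq0 : mu != 0.

(** Modulo [mu], the difference quotient of [mu] for the functional L(a .) is
    [a] times the one for [L], and its degree is below that of [mu]. *)
Lemma diffquo_shift_eq0 (L : {scalar {poly E}}) a :
    (forall r, L (mu * r) = 0) -> mu %| a * diffquo L mu ->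
  diffquo (shift_form L a) mu = 0.
Proof.
move=> L_mu dvd_mu.
have nu_shift_mu : diffquo (shift_form L mu) a = 0.
  by apply/polyP=> b; rewrite coef_diffquo coef0; apply: L_mu.
(* Both expansions of the difference quotient of the product of mu and a. *)
have eq_nu : a * diffquo L mu = mu * diffquo L a + diffquo (shift_form L a) mu.
  by rewrite -diffquoM mulrC [mu * a]mulrC diffquoM nu_shift_mu addr0 mulrC.
apply: contraTeq (size_diffquo_lt (shift_form L a) mu_neq0) => nu_neq0.
rewrite -leqNgt dvdp_leq //.
by move: dvd_mu; rewrite eq_nu dvdp_addr ?dvdp_mulIl.
Qed.

(** For [La := L (a * _)], the difference quotient of [mu] is zero, so that
    applying [diffquo_shift_eq0] to [La] makes all difference quotients for [La]
    vanish. Their constant terms then give back [La] itself, since [La r] is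
    the constant term of the difference quotient of [r * 'X]. *)
Lemma dvdp_mul_diffquo (L : {scalar {poly E}}) a :
    (forall r, L (mu * r) = 0) -> mu %| a * diffquo L mu ->
  forall r, L (a * r) = 0.
Proof.
move=> L_mu dvd_mu r; pose La : {scalar {poly E}} := shift_form L a.
have nu_a : diffquo La mu = 0 := diffquo_shift_eq0 L_mu dvd_mu.
rewrite -[L _]/(La r).
have La_mu s : La (mu * s) = 0 by rewrite -[La _]/(L (a * _)) mulrCA L_mu.
have nu_mu_shift : diffquo (shift_form La mu) (r * 'X) = 0.
  by apply/polyP=> b; rewrite coef_diffquo coef0; apply: La_mu.
have nu_shift_mu : diffquo (shift_form La (r * 'X)) mu = 0.
  by apply: diffquo_shift_eq0; rewrite // nu_a mulr0 dvdp0.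
have /eqP : mu * diffquo La (r * 'X) = 0.
  rewrite -[LHS]addr0 -nu_shift_mu -diffquoM mulrC diffquoM nu_mu_shift.
  by rewrite nu_a mulr0 addr0.
rewrite mulf_eq0 (negPf mu_neq0) /= => /eqP/polyP/(_ 0).
by rewrite diffquoMX coefD coefMX coefC coef0 /= add0r.
Qed.
End Coprimality.

(** * Irreducibility of polynomials of degree one in the parameter *)

Lemma fraction_denominator (R : idomainType) (c : {fraction R}) :
  exists2 d, d != 0 & exists n, tofrac n = tofrac d * c.
Proof.
elim/quotW: c => r; have d_neq0 : \d_r != 0 := denom_ratioP r.
exists \d_r => //; exists \n_r.
rewrite -[RHS]/(FracField.mul _ _) !piE; apply/eqP; rewrite eqmodE /=.
have one_neq0 := oner_neq0 R.
rewrite FracField.equivfE /FracField.mulf !numden_Ratio ?mulf_neq0 //.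
by rewrite !mul1r mulrC.
Qed.

Lemma mulf_quotient_step (K : fieldType) (m n N y c : K) : n != 0 ->
  n * N * (y * (m / n) + c) = m * (N * y) + n * N * c.
Proof. by move=> n_neq0; field. Qed.

Section Pencil.
Variable F : fieldType.
Implicit Types (mu nu : {poly F}) (f g : {poly {poly F}}).

Local Notation frac := (@tofrac {poly F}).

Lemma clear_denominators (q : {poly {fraction {poly F}}}) :
  exists2 d : {poly F}, d != 0 &
    exists q' : {poly {poly F}}, map_poly frac q' = frac d *: q.
Proof.
elim/poly_ind: q => [|q c [d d_neq0 [q' q'E]]].
  by exists 1; rewrite ?oner_neq0 //; exists 0; rewrite rmorph0 scaler0.
have [d' d'_neq0 [c' c'E]] := fraction_denominator c.
exists (d * d'); first by rewrite mulf_neq0.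
exists (d' *: q' * 'X + (d * c')%:P).
rewrite rmorphD rmorphM /= map_polyX map_polyC linearZ /= q'E tofracM c'E.
rewrite scalerDr scalerAl scalerA -tofracM [d' * d]mulrC; congr (_ + _).
by rewrite -mul_polyC -polyCM tofracM mulrA.
Qed.

Lemma clear_powers mu nu g : nu != 0 ->
  exists N h, frac (nu ^+ N) * (map_poly frac g).[frac mu / frac nu] = frac h.
Proof.
move=> nu_neq0; elim/poly_ind: g => [|g c [N [h hE]]].
  by exists 0, 0; rewrite rmorph0 horner0 mulr0 tofrac0.
exists N.+1, (mu * h + nu ^+ N.+1 * c).
rewrite rmorphD rmorphM /= map_polyX map_polyC hornerMXaddC.
rewrite tofracD !tofracM -hE exprS tofracM.
by rewrite mulf_quotient_step // tofrac_eq0.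
Qed.

(** The rational root theorem, for the lowest nonzero coefficient [g`_i]:
    clearing denominators in g(mu / nu) = 0 shows that [mu] divides
    [nu ^+ N * g`_i] for some [N]. *)
Lemma root_quotient_dvdp mu nu g :
    coprimep mu nu -> mu != 0 -> nu != 0 -> g != 0 ->
    root (map_poly frac g) (frac mu / frac nu) ->
  exists2 i, g`_i != 0 & mu %| g`_i.
Proof.
move=> co_mu_nu mu_neq0 nu_neq0; elim/poly_ind: g => [|g c IHg].
  by rewrite eqxx.
rewrite /root rmorphD rmorphM /= map_polyX map_polyC hornerMXaddC.
have [-> | c_neq0 _ root_g] := eqVneq c 0.
  rewrite rmorph0 !addr0.
  rewrite mulf_eq0 polyX_eq0 orbF => g_neq0.
  have x_neq0 : frac mu / frac nu != 0.
    by rewrite mulf_neq0 ?invr_eq0 ?tofrac_eq0.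
  rewrite mulf_eq0 (negPf x_neq0) orbF.
  by case/IHg=> // i gi_neq0 dvd_i; exists i.+1; rewrite coefMX.
exists 0; rewrite coefD coefMX coefC add0r //=.
have [N [h hE]] := clear_powers mu g nu_neq0.
have : nu ^+ N.+1 * c = - (mu * h).
  apply/eqP; rewrite -addr_eq0 -tofrac_eq0; apply/eqP.
  rewrite addrC tofracD !tofracM -hE exprS tofracM.
  have frac_nu_neq0 : frac nu != 0 by rewrite tofrac_eq0.
  have := mulf_quotient_step (frac mu) (frac (nu ^+ N))
    (map_poly frac g).[frac mu / frac nu] (frac c) frac_nu_neq0.
  rewrite (eqP root_g) mulr0 => /esym; exact.
move=> eq_c; have : mu %| nu ^+ N.+1 * c by rewrite eq_c dvdpNr dvdp_mulIl.
by rewrite Gauss_dvdpr ?coprimep_expr.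
Qed.

(** Here the outer variable is t and the inner one is Q: the notation ['Y]
    stands for the constant polynomial ['X%:P]. *)
Definition pencil mu nu : {poly {poly F}} := mu^:P - 'Y * nu^:P.

Section Irreducibility.
Variables mu nu : {poly F}.
Hypotheses (mu_gt1 : (1 < size mu)%N) (nu_lt : (size nu < size mu)%N).
Hypothesis co_mu_nu : coprimep mu nu.

Let size_nu_lift : (size ('Y * nu^:P)%R < size mu^:P)%N.
Proof.
rewrite size_map_polyC mul_polyC; apply: leq_ltn_trans nu_lt.
by rewrite (leq_trans (size_scale_leq _ _)) ?size_map_polyC.
Qed.

Lemma size_pencil : size (pencil mu nu) = size mu.
Proof. by rewrite size_polyDl ?size_polyN // size_map_polyC. Qed.

Lemma lead_coef_pencil : lead_coef (pencil mu nu) = (lead_coef mu)%:P.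
Proof.
by rewrite lead_coefDl ?size_polyN // lead_coef_map_inj //; apply: polyC_inj.
Qed.

Let mu_neq0 : mu != 0.
Proof. by rewrite -size_poly_gt0 ltnW. Qed.

Let nu_neq0 : nu != 0.
Proof.
apply: contraTneq co_mu_nu => ->.
by rewrite coprimep0 -size_poly_eq1 neq_ltn mu_gt1 orbT.
Qed.

(** The ring morphism from F[Q,t] to F(t) sending Q to [mu / nu] and fixing t;
    [swapXY] makes Q the outer variable, the one that is evaluated. *)
Let subst f := (map_poly frac (swapXY f)).[frac mu / frac nu].

Let substM f g : subst (f * g) = subst f * subst g.
Proof. by rewrite /subst !rmorphM hornerM. Qed.

Let subst_pencil : subst (pencil mu nu) = 0.
Proof.
rewrite /subst /pencil !rmorphB !rmorphM /= swapXY_Y !swapXY_map_polyC.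
rewrite map_polyX !map_polyC /= !hornerE /= divfK ?subrr //.
by rewrite tofrac_eq0.
Qed.

Let size_subst0 f : f != 0 -> subst f = 0 -> (size mu <= size f)%N.
Proof.
rewrite -swapXY_eq0 => f_neq0 /eqP/root_quotient_dvdp[] // i fi_neq0 dvd_i.
rewrite (leq_trans (dvdp_leq fi_neq0 dvd_i)) //.
have -> : size f = sizeY (swapXY f) by rewrite sizeYE swapXYK.
exact: max_size_coefXY.
Qed.

(** After clearing denominators in a factorization, one of the two factors
    vanishes at Q = mu / nu, hence has full degree in t; the other one is then
    constant in t. *)
Lemma pencil_irreducible_frac : irreducible_poly (map_poly frac (pencil mu nu)).
Proof.
have frac_inj : injective frac.
  by move=> x y /eqP; rewrite tofrac_eq => /eqP.
have size_frac f : size (map_poly frac f) = size f.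
  by apply: size_map_inj_poly => //; apply: tofrac0.
split=> [|q size_q dvd_q]; first by rewrite size_frac size_pencil.
have p_neq0 : map_poly frac (pencil mu nu) != 0.
  by rewrite -size_poly_gt0 size_frac size_pencil ltnW.
rewrite -dvdp_size_eqp // eqn_leq dvdp_leq //= size_frac size_pencil.
have /dvdpP[b pE] : q %| map_poly frac (pencil mu nu) by [].
have [d d_neq0 [q' q'E]] := clear_denominators q.
have [e e_neq0 [b' b'E]] := clear_denominators b.
have dF : frac d != 0 by rewrite tofrac_eq0.
have eF : frac e != 0 by rewrite tofrac_eq0.
have [b_neq0 q_neq0] : b != 0 /\ q != 0.
  by apply/andP; rewrite -negb_or -mulf_eq0 -pE.
have size_q' : size q' = size q.
  by move: (size_scale q dF); rewrite -q'E size_frac.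
have size_b' : size b' = size b.
  by move: (size_scale b eF); rewrite -b'E size_frac.
have eq_p : (e * d)%:P * pencil mu nu = b' * q'.
  apply: (map_inj_poly frac_inj (tofrac0 _)).
  rewrite [LHS]rmorphM [RHS]rmorphM /= map_polyC /= pE b'E q'E mul_polyC.
  by rewrite -scalerAl -scalerAr scalerA tofracM.
have /eqP : subst b' * subst q' = 0.
  by rewrite -substM -eq_p substM subst_pencil mulr0.
rewrite mulf_eq0 => /orP[] /eqP /size_subst0 size_le; last first.
  by rewrite -size_q' size_le // -size_poly_gt0 size_q' size_poly_gt0.
have {size_le} : (size mu <= size b)%N.
  by rewrite -size_b' size_le // -size_poly_gt0 size_b' size_poly_gt0.
have size_mu : size mu = (size b + size q).-1.
  by rewrite -size_pencil -size_frac pE size_mul.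
have size_q_gt1 : (1 < size q)%N.
  by rewrite ltn_neqAle eq_sym size_q size_poly_gt0.
by rewrite size_mu leqNgt => /negP[]; rewrite -subn1 ltn_subRL addnC ltn_add2l.
Qed.

End Irreducibility.
End Pencil.

(** Over the fraction field one factor is constant; being monic, the polynomial
    forces the leading coefficients of both factors to be units, so that the
    constant factor is a unit of the base ring. *)
Lemma monic_irreducible_frac (D : idomainType) (p : {poly D}) :
    p \is monic -> irreducible_poly (map_poly (@tofrac D) p) ->
  irreducible_elem p.
Proof.
move=> p_monic [p_gt1 p_irr].
have frac_inj : injective (@tofrac D).
  by move=> x y /eqP; rewrite tofrac_eq => /eqP.
have size_frac f : size (map_poly (@tofrac D) f) = size f.
  by apply: size_map_inj_poly => //; apply: tofrac0.
rewrite size_frac in p_gt1.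
split=> [||a b pE]; first exact: monic_neq0.
  by rewrite poly_unitE gtn_eqF.
have lead_ab : lead_coef a * lead_coef b = 1.
  by rewrite -lead_coefM -pE (monicP p_monic).
have const_unit (f g : {poly D}) :
    lead_coef f * lead_coef g = 1 -> size f = 1 -> f \is a GRing.unit.
  move=> lead_fg size_f; rewrite poly_unitE size_f /=; apply/unitrPr.
  exists (lead_coef g).
  by move: lead_fg; rewrite [lead_coef f]lead_coefE size_f.
have [size_a | size_a] := eqVneq (size a) 1.
  by left; apply: const_unit lead_ab size_a.
right; apply: (const_unit b a); first by rewrite mulrC.
have /p_irr : size (map_poly (@tofrac D) a) != 1 by rewrite size_frac.
rewrite pE rmorphM /= dvdp_mulIl => /(_ isT)/eqp_size.
have [a_neq0 b_neq0] : a != 0 /\ b != 0.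
  by apply/andP; rewrite -negb_or -mulf_eq0 -pE monic_neq0.
rewrite -rmorphM !size_frac size_mul //.
move: a_neq0 b_neq0; rewrite -!size_poly_gt0 => a_gt0 b_gt0.
rewrite -(prednK a_gt0) -(prednK b_gt0) addSn addnS /=.
by rewrite -[LHS]addn0 -addSn => /addnI <-.
Qed.
(** * Polynomials of a matrix applied to a vector *)

Section PolynomialsOfMatrices.
Variable C : numClosedFieldType.
Implicit Types (p q : {poly C}).

Lemma mx_poly_apply_wide n (A : 'M[C]_n) p (w : 'cV[C]_n) N :
  (size p <= N)%N -> mx_poly_apply A p w = \sum_(i < N) p`_i *: (A ^+ i *m w).
Proof.
move=> le_pN; rewrite /mx_poly_apply.
rewrite (big_ord_widen N (fun i => p`_i *: (A ^+ i *m w))) //.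
rewrite [RHS](bigID (fun i : 'I_N => (i < size p)%N)) /=.
rewrite [X in _ + X]big1 ?addr0 //.
by move=> i; rewrite -leqNgt => le_i; rewrite nth_default ?scale0r.
Qed.

Fact mx_poly_apply_is_linear n (A : 'M[C]_n) (w : 'cV[C]_n) :
  linear (fun p => mx_poly_apply A p w).
Proof.
move=> k p q; pose N := maxn (size p) (size q).
have leN : (size (k *: p + q)%R <= N)%N.
  rewrite (leq_trans (size_polyD _ _)) // geq_max leq_maxr andbT.
  by rewrite (leq_trans (size_scale_leq _ _)) ?leq_maxl.
rewrite !(@mx_poly_apply_wide _ _ _ _ N) ?leq_maxl ?leq_maxr //.
rewrite scaler_sumr -big_split /=; apply: eq_bigr => i _.
by rewrite coefD coefZ scalerDl scalerA.
Qed.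

Section OneMatrix.
Variables (n : nat) (A : 'M[C]_n).

Lemma mx_poly_apply0 w : mx_poly_apply A 0 w = 0.
Proof. by rewrite /mx_poly_apply size_poly0 big_ord0. Qed.

Lemma mx_poly_applyD w p q :
  mx_poly_apply A (p + q) w = mx_poly_apply A p w + mx_poly_apply A q w.
Proof. by rewrite -[p]scale1r mx_poly_apply_is_linear !scale1r. Qed.

Lemma mx_poly_applyZ w k p :
  mx_poly_apply A (k *: p) w = k *: mx_poly_apply A p w.
Proof.
by rewrite -[k *: p]addr0 mx_poly_apply_is_linear mx_poly_apply0 addr0.
Qed.

Lemma mx_poly_applyB w p q :
  mx_poly_apply A (p - q) w = mx_poly_apply A p w - mx_poly_apply A q w.
Proof. by rewrite -scaleN1r mx_poly_applyD mx_poly_applyZ scaleN1r. Qed.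

Lemma mx_poly_applyC w c : mx_poly_apply A c%:P w = c *: w.
Proof.
rewrite (@mx_poly_apply_wide _ _ _ _ 1) ?size_polyC_leq1 //.
by rewrite big_ord1 coefC /= expr0 mul1mx.
Qed.

Lemma mx_poly_applyMX w p :
  mx_poly_apply A (p * 'X) w = A *m mx_poly_apply A p w.
Proof.
rewrite (@mx_poly_apply_wide _ _ _ _ (size p).+1); last first.
  by have [->|p_neq0] := eqVneq p 0; rewrite ?mul0r ?size_poly0 ?size_mulX.
rewrite big_ord_recl coefMX scale0r add0r mulmx_sumr; apply: eq_bigr => i _.
by rewrite coefMX /= exprS -scalemxAr mulmxA.
Qed.

Lemma mx_poly_applyM w p q :
  mx_poly_apply A (p * q) w = mx_poly_apply A p (mx_poly_apply A q w).
Proof.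
elim/poly_ind: p => [|p c IHp]; first by rewrite mul0r !mx_poly_apply0.
rewrite mulrDl mulrAC mul_polyC !mx_poly_applyD mx_poly_applyZ !mx_poly_applyMX.
by rewrite mx_poly_applyC IHp.
Qed.

Lemma mx_poly_apply_mul w p :
  mx_poly_apply A p (A *m w) = A *m mx_poly_apply A p w.
Proof.
have := mx_poly_applyMX w 1; rewrite mul1r mx_poly_applyC scale1r => applyX.
by rewrite -mx_poly_applyMX mx_poly_applyM applyX.
Qed.

Lemma mx_poly_apply_scale w k p :
  mx_poly_apply A p (k *: w) = k *: mx_poly_apply A p w.
Proof.
by rewrite -mx_poly_applyC -mx_poly_applyM mulrC mx_poly_applyM mx_poly_applyC.
Qed.

Lemma relative_minpolyZ w k p : k != 0 ->
  relative_minpoly A (k *: w) p -> relative_minpoly A w p.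
Proof.
move=> k_neq0 [p_monic /eqP p_w p_min]; split=> // [|q q_monic q_w].
  by move: p_w; rewrite mx_poly_apply_scale scaler_eq0 (negPf k_neq0) => /eqP.
by apply: p_min => //; rewrite mx_poly_apply_scale q_w scaler0.
Qed.

Lemma relative_minpoly_leq w p q :
  relative_minpoly A w p -> q != 0 -> mx_poly_apply A q w = 0 ->
  (size p <= size q)%N.
Proof.
move=> [_ _ p_min] q_neq0 q_w; have lead_neq0 : (lead_coef q)^-1 != 0.
  by rewrite invr_eq0 lead_coef_eq0.
rewrite -(size_scale q lead_neq0) p_min ?mx_poly_applyZ ?q_w ?scaler0 //.
by rewrite monicE lead_coefZ mulVf ?lead_coef_eq0.
Qed.

Lemma relative_minpoly_unique w p q :
    relative_minpoly A w p -> q \is monic -> size q = size p ->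
    mx_poly_apply A q w = 0 ->
  q = p.
Proof.
move=> p_min q_monic size_q q_w; have [p_monic p_w _] := p_min.
apply/eqP; rewrite -subr_eq0; apply/negPn/negP => pq_neq0.
have := relative_minpoly_leq p_min pq_neq0.
rewrite mx_poly_applyB q_w p_w subr0 => /(_ erefl).
rewrite leqNgt => /negP[].
have p_gt0 : (0 < size p)%N by rewrite size_poly_gt0 monic_neq0.
rewrite -(prednK p_gt0) ltnS; apply/leq_sizeP => i le_i.
rewrite coefB; move: le_i; rewrite leq_eqVlt => /predU1P[<-|lt_i].
  by rewrite -{1}size_q -!lead_coefE (monicP q_monic) (monicP p_monic) subrr.
by rewrite !nth_default ?subr0 // ?size_q; rewrite -(prednK p_gt0).
Qed.

Lemma relative_minpoly_gt1 w p :
  w != 0 -> relative_minpoly A w p -> (1 < size p)%N.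
Proof.
move=> w_neq0 [p_monic p_w _]; rewrite ltnNge; apply: contraNN w_neq0 => p_le1.
have p1 : p = 1.
  have c_p := size1_polyC p_le1; move: p_monic; rewrite c_p monicE lead_coefC.
  by move/eqP->.
by rewrite -[w]scale1r -mx_poly_applyC -p_w p1.
Qed.
End OneMatrix.

End PolynomialsOfMatrices.

(** * Moment functionals, and the effect of a rank one update *)

Section MomentForm.
Variable E : fieldType.
Variables (n : nat) (y : 'rV[E]_n) (A : 'M[E]_n) (w : 'cV[E]_n).

(** The functional q |-> y q(A) w, written through the moments y A^i w so that
    it makes sense over any field and commutes with field extensions. *)
Definition moment_form (q : {poly E}) : E :=
  \sum_(i < size q) q`_i * (y *m (A ^+ i *m w)) 0 0.

Lemma moment_form_wide (q : {poly E}) N : (size q <= N)%N ->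
  moment_form q = \sum_(i < N) q`_i * (y *m (A ^+ i *m w)) 0 0.
Proof.
move=> le_qN; rewrite /moment_form.
rewrite (big_ord_widen N (fun i => q`_i * (y *m (A ^+ i *m w)) 0 0)) //.
rewrite [RHS](bigID (fun i : 'I_N => (i < size q)%N)) /=.
rewrite [X in _ + X]big1 ?addr0 //.
by move=> i; rewrite -leqNgt => le_i; rewrite nth_default ?mul0r.
Qed.

Fact moment_form_is_scalar : scalar moment_form.
Proof.
move=> k p q; pose N := maxn (size p) (size q).
have leN : (size (k *: p + q)%R <= N)%N.
  rewrite (leq_trans (size_polyD _ _)) // geq_max leq_maxr andbT.
  by rewrite (leq_trans (size_scale_leq _ _)) ?leq_maxl.
rewrite !(@moment_form_wide _ N) ?leq_maxl ?leq_maxr //.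
rewrite mulr_sumr -big_split /=; apply: eq_bigr => i _.
by rewrite coefD coefZ mulrDl mulrA.
Qed.

HB.instance Definition _ :=
  GRing.isLinear.Build E {poly E} E *%R moment_form moment_form_is_scalar.
End MomentForm.

Lemma moment_formE (C : numClosedFieldType) n (y : 'rV[C]_n) A w q :
  moment_form y A w q = (y *m mx_poly_apply A q w) 0 0.
Proof.
rewrite mulmx_sumr summxE; apply: eq_bigr => i _.
by rewrite -scalemxAr [RHS]mxE.
Qed.

Lemma map_moment_form (F L : fieldType) (iota : {rmorphism F -> L}) n
    (y : 'rV[F]_n) A w q :
  iota (moment_form y A w q) =
    moment_form (map_mx iota y) (map_mx iota A) (map_mx iota w)
      (map_poly iota q).
Proof.
rewrite /moment_form size_map_poly rmorph_sum; apply: eq_bigr => i _.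
by rewrite rmorphM coef_map -(rmorphXn (map_mx iota)) -!map_mxM [in RHS]mxE.
Qed.

Lemma map_diffquo (F L : fieldType) (iota : {rmorphism F -> L})
    (lF : {scalar {poly F}}) (lL : {scalar {poly L}}) (q : {poly F}) :
    (forall p, lL (map_poly iota p) = iota (lF p)) ->
  map_poly iota (diffquo lF q) = diffquo lL (map_poly iota q).
Proof.
move=> l_iota; apply/polyP => b; rewrite coef_map /= !coef_diffquo -l_iota.
by congr (lL _); apply/polyP => i; rewrite coef_map !coef_drop_poly coef_map.
Qed.

Section Update.
Variables (E : fieldType) (L : {scalar {poly E}}) (Q : E).

(** The polynomial whose value at the updated matrix agrees with that of [q] at
    the original one, on the cyclic vector; see [mx_poly_apply_update]. *)
Definition update q := q - Q *: diffquo L q.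

Lemma update_is_linear : linear update.
Proof.
move=> k p q; rewrite /update linearP /= scalerDr opprD addrACA scalerBr.
by rewrite !scalerA mulrC.
Qed.

HB.instance Definition _ :=
  GRing.isLinear.Build E {poly E} {poly E} *:%R update update_is_linear.

Lemma size_sub_update (q : {poly E}) :
  (size (Q *: diffquo L q)%R <= (size q).-1)%N.
Proof. by rewrite (leq_trans (size_scale_leq _ _)) ?size_diffquo. Qed.

Lemma small_add_monic (p r : {poly E}) :
    p \is monic -> (size r <= (size p).-1)%N ->
  p + r \is monic /\ size (p + r) = size p.
Proof.
move=> p_monic le_r; have lt_r : (size r < size p)%N.
  by rewrite (leq_ltn_trans le_r) // prednK ?size_poly_gt0 ?monic_neq0.
by rewrite monicE lead_coefDl // size_polyDl.
Qed.

Lemma update_monic q :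
  q \is monic -> update q \is monic /\ size (update q) = size q.
Proof.
move=> q_monic.
by apply: small_add_monic; rewrite ?size_polyN ?size_sub_update.
Qed.

(** [update] differs from the identity by a map lowering degrees, so it is onto;
    the bound on [r] says that a preimage of [q] can be found with the same
    leading term as [q]. *)
Lemma update_surj (q : {poly E}) :
  exists2 r : {poly E}, (size r <= (size q).-1)%N & update (q + r) = q.
Proof.
have [N] := ubnP (size q); elim: N q => // N IHN q le_q.
have [-> | q_neq0] := eqVneq q 0.
  by exists 0; rewrite ?size_poly0 // addr0 linear0.
have lt_nu : (size (Q *: diffquo L q)%R < size q)%N.
  by rewrite (leq_ltn_trans (size_sub_update q)) // prednK ?size_poly_gt0.
have [|r le_r rE] := IHN (Q *: diffquo L q); first by apply: leq_trans lt_nu _.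
exists (Q *: diffquo L q + r).
  rewrite (leq_trans (size_polyD _ _)) // geq_max size_sub_update.
  by rewrite (leq_trans le_r) // (leq_trans (leq_pred _)) ?size_sub_update.
by rewrite linearD /= rE /update subrK.
Qed.
End Update.

Section MatrixUpdate.
Variables (C : numClosedFieldType) (n : nat) (y : 'rV[C]_n) (A D : 'M[C]_n).
Variables (u : 'cV[C]_n) (Q : C).
Local Notation L := (moment_form y A u).
Hypothesis D_rank1 : forall q, D *m mx_poly_apply A q u = L q *: u.

(** By Horner's scheme: multiplying by A = B - Q D costs the correction
    Q L(q) u, which is what the recursion of [diffquo] accumulates. *)
Lemma mx_poly_apply_update q :
  mx_poly_apply (A + Q *: D) (update L Q q) u = mx_poly_apply A q u.
Proof.
elim/poly_ind: q => [|q c IHq]; first by rewrite linear0 !mx_poly_apply0.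
have -> : update L Q (q * 'X + c%:P) = update L Q q * 'X + (c - Q * L q)%:P.
  rewrite /update linearD /= diffquoC diffquoMX addr0 mulrBl scalerDr -scalerAl.
  by rewrite polyCB polyCM mul_polyC; ring.
rewrite !mx_poly_applyD !mx_poly_applyMX !mx_poly_applyC IHq mulmxDl -scalemxAl.
by rewrite D_rank1 scalerBl scalerA -addrA; congr (_ + _); rewrite addrC subrK.
Qed.

Lemma relative_minpoly_update p :
  relative_minpoly (A + Q *: D) u p ->
  exists2 mu, relative_minpoly A u mu & p = update L Q mu.
Proof.
move=> [p_monic p_u p_min]; have [r size_r pE] := update_surj L Q p.
have [mu_monic size_mu] := small_add_monic p_monic size_r.
exists (p + r) => //; split=> // [|q q_monic q_u].
  by rewrite -mx_poly_apply_update pE.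
have [uq_monic size_uq] := update_monic L Q q_monic.
by rewrite size_mu -size_uq p_min // mx_poly_apply_update.
Qed.
End MatrixUpdate.

Section Descent.
Variables (F : fieldType) (C : numClosedFieldType) (iota : {rmorphism F -> C}).
Variables (n : nat) (A : 'M[F]_n) (w : 'cV[F]_n).

(** Field extensions preserve membership in a row space, so the first linear
    dependency among the vectors A^i w is already present over the small field;
    uniqueness of the relative minimal polynomial identifies the two. *)
Lemma relative_minpoly_descent p :
  relative_minpoly (map_mx iota A) (map_mx iota w) p ->
  exists2 pF, pF \is monic & p = map_poly iota pF.
Proof.
move=> p_min; have [p_monic p_w _] := p_min.
have p_gt0 : (0 < size p)%N by rewrite size_poly_gt0 monic_neq0.
pose d := (size p).-1; have size_p : size p = d.+1 by rewrite prednK.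
pose kry : 'M[F]_(d, n) := \matrix_(i < d) (A ^+ i *m w)^T.
have mapE i : map_mx iota (A ^+ i *m w) = (map_mx iota A) ^+ i *m map_mx iota w.
  by rewrite map_mxM (rmorphXn (map_mx iota)).
have /submxP[c cE] : ((A ^+ d *m w)^T <= kry)%MS.
  rewrite -(map_submx iota); apply/submxP; exists (\row_i (- p`_i)).
  move: p_w; rewrite (@mx_poly_apply_wide _ _ _ _ _ d.+1) ?size_p //.
  rewrite big_ord_recr /= -[p`_d]lead_coefE (monicP p_monic) scale1r.
  move/eqP; rewrite addrC addr_eq0 => /eqP eq_d.
  rewrite -map_trmx mapE eq_d; apply/matrixP=> i j; rewrite !mxE summxE.
  by rewrite -sumrN; apply: eq_bigr => k _; rewrite -mapE !mxE mulNr (ord1 i).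
have [] := @small_add_monic _ 'X^d (- rVpoly c) (monicXn _ _).
  by rewrite size_polyN size_polyXn size_poly.
rewrite size_polyXn; set pF := 'X^d - rVpoly c => pF_monic size_pF.
exists pF => //; apply/esym/(relative_minpoly_unique p_min).
- exact: monic_map.
- by rewrite size_map_poly size_pF.
have coef_pF (i : 'I_d) : pF`_i = - c 0 i.
  by rewrite coefB coefXn ltn_eqF // coef_rVpoly_ord sub0r.
have lead_pF : pF`_d = 1.
  by move: (monicP pF_monic); rewrite lead_coefE size_pF.
rewrite (@mx_poly_apply_wide _ _ _ _ _ d.+1) ?size_map_poly ?size_pF //.
rewrite big_ord_recr /= coef_map /= lead_pF rmorph1 scale1r -mapE.
apply/eqP; rewrite addrC addr_eq0 -[A ^+ d *m w]trmxK cE -sumrN.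
apply/eqP/matrixP=> i j; rewrite !mxE summxE rmorph_sum; apply: eq_bigr => k _.
by rewrite coef_map /= coef_pF -mapE !mxE rmorphM rmorphN mulNr opprK (ord1 j).
Qed.
End Descent.
(** * Coprimality for Hermitian matrices *)

Section HermitianCoprimality.
Variables (C : numClosedFieldType) (n : nat) (A : 'M[C]_n) (u : 'cV[C]_n).
Hypothesis A_herm : A ^t* = A.
Local Notation L := (moment_form (u ^t*) A u).

Lemma adjoint_mx_poly_apply p (x : 'cV[C]_n) :
  (mx_poly_apply A p u) ^t* *m x =
    u ^t* *m mx_poly_apply A (map_poly Num.Def.conjC p) x.
Proof.
elim/poly_ind: p x => [|p c IHp] x.
  by rewrite rmorph0 !mx_poly_apply0 trmx0 map_mx0 mul0mx mulmx0.
rewrite rmorphD rmorphM /= map_polyX map_polyC /=.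
rewrite !mx_poly_applyD !mx_poly_applyC.
rewrite !mx_poly_applyMX linearD /= map_mxD mulmxDl mulmxDr linearZ /= map_mxZ.
rewrite trmx_mul map_mxM A_herm -mulmxA IHp mx_poly_apply_mul.
by rewrite -scalemxAl -scalemxAr.
Qed.

Lemma adjoint_mul_eq0 (x : 'cV[C]_n) : (x ^t* *m x) 0 0 = 0 -> x = 0.
Proof.
rewrite mxE => /eqP; rewrite psumr_eq0 => [/allP x0|i _].
  apply/matrixP => i j; rewrite (ord1 j) [RHS]mxE; apply/eqP.
  have := x0 i (mem_index_enum i); rewrite !mxE /= mulrC -normCK.
  by rewrite expf_eq0 normr_eq0.
by rewrite !mxE mulrC -normCK exprn_ge0.
Qed.

(** The quotient of [diffquo L mu] by [mu] is the partial fraction sum of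
    |c_i|^2 / (t - lambda_i), with c_i the nonzero components of [u] along the
    eigenspaces of [A]; it is in lowest terms because no |c_i|^2 vanishes. The
    proof replaces the spectral decomposition by the positivity of the scalar
    product. *)
Lemma coprimep_diffquo mu :
  relative_minpoly A u mu -> coprimep mu (diffquo L mu).
Proof.
move=> mu_min; have [mu_monic mu_u _] := mu_min.
have mu_neq0 := monic_neq0 mu_monic.
set nu := diffquo L mu; rewrite /coprimep; set g := gcdp mu nu.
have /dvdpP[a muE] : g %| mu by rewrite dvdp_gcdl.
have /dvdpP[b nuE] : g %| nu by rewrite dvdp_gcdr.
have [a_neq0 g_neq0] : a != 0 /\ g != 0.
  by apply/andP; rewrite -negb_or -mulf_eq0 -muE.
have L_mu r : L (mu * r) = 0.
  rewrite moment_formE mulrC mx_poly_applyM mu_u.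
  by rewrite -(scale0r u) mx_poly_apply_scale scale0r mulmx0 mxE.
have L_a : forall r, L (a * r) = 0.
  apply: (dvdp_mul_diffquo mu_neq0 L_mu).
  by rewrite -/nu nuE {1}muE mulrCA dvdp_mulIr.
have a_u : mx_poly_apply A a u = 0.
  apply: adjoint_mul_eq0; rewrite adjoint_mx_poly_apply -mx_poly_applyM mulrC.
  by rewrite -moment_formE L_a.
have := relative_minpoly_leq mu_min a_neq0 a_u.
rewrite muE size_mul // => le_a.
have g_gt0 : (0 < size g)%N by rewrite size_poly_gt0.
have a_gt0 : (0 < size a)%N by rewrite size_poly_gt0.
rewrite eqn_leq g_gt0 andbT -(leq_add2l (size a)).
by rewrite addn1; case: (size a + size g)%N le_a.
Qed.
End HermitianCoprimality.

(** * Orthonormal eigenbases *)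

Section Orthonormal.
Variables (C : numClosedFieldType) (n : nat) (w : 'I_n -> 'cV[C]_n).
Hypothesis w_orthonormal : orthonormal_basis w.

Lemma orthonormal_resolution : \sum_i w i *m (w i) ^t* = 1%:M.
Proof.
pose W : 'M[C]_n := \matrix_(x, i) w i x 0.
have W_unit : W ^t* *m W = 1%:M.
  apply/matrixP => j i; rewrite [RHS]mxE eq_sym -(w_orthonormal i j) !mxE.
  by apply: eq_bigr => x _; rewrite !mxE.
rewrite -(mulmx1C W_unit); apply/matrixP => x y; rewrite summxE mxE.
by apply: eq_bigr => i _; rewrite !mxE big_ord1 !mxE.
Qed.

Lemma orthonormal_expand (x : 'cV[C]_n) :
  x = \sum_i ((w i) ^t* *m x) 0 0 *: w i.
Proof.
rewrite -[LHS]mul1mx -orthonormal_resolution mulmx_suml; apply: eq_bigr => i _.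
by rewrite -mulmxA {1}[_ *m x]mx11_scalar mul_mx_scalar.
Qed.

Lemma orthonormal_expand_row (y : 'rV[C]_n) :
  y = \sum_i (y *m w i) 0 0 *: (w i) ^t*.
Proof.
rewrite -[LHS]mulmx1 -orthonormal_resolution mulmx_sumr; apply: eq_bigr => i _.
by rewrite mulmxA {1}[y *m w i]mx11_scalar mul_scalar_mx.
Qed.

Lemma orthonormal_neq0 i : w i != 0.
Proof.
apply/eqP => wi0; have := w_orthonormal i i; rewrite wi0 mulmx0 mxE eqxx.
by move/eqP; rewrite eq_sym oner_eq0.
Qed.

Variables (H : 'M[C]_n) (theta : 'I_n -> C).
Hypothesis w_eigen : forall i, H *m w i = theta i *: w i.

Lemma eigen_row_orthogonal (y : 'rV[C]_n) a i :
  y *m H = a *: y -> a != theta i -> (y *m w i) 0 0 = 0.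
Proof.
move=> y_eigen neq_a; apply/eqP.
have : (a - theta i) * (y *m w i) 0 0 == 0.
  have : (y *m H *m w i) 0 0 = (y *m (H *m w i)) 0 0 by rewrite mulmxA.
  rewrite y_eigen w_eigen -scalemxAl -scalemxAr [LHS]mxE [RHS]mxE => E.
  by rewrite mulrBl E subrr.
by rewrite mulf_eq0 subr_eq0 (negPf neq_a).
Qed.

Lemma adjoint_eigen i : (w i) ^t* *m H = theta i *: (w i) ^t*.
Proof.
rewrite [LHS]orthonormal_expand_row (bigD1 i) //= big1 ?addr0 => [|j neq_ji].
  by rewrite -mulmxA w_eigen -scalemxAr mxE w_orthonormal eqxx mulr1.
rewrite -mulmxA w_eigen -scalemxAr mxE w_orthonormal (negPf neq_ji) mulr0.
by rewrite scale0r.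
Qed.

Lemma eigen_col_orthogonal (x : 'cV[C]_n) a i :
  H *m x = a *: x -> a != theta i -> ((w i) ^t* *m x) 0 0 = 0.
Proof.
move=> x_eigen neq_a; apply/eqP.
have : (a - theta i) * ((w i) ^t* *m x) 0 0 == 0.
  have : ((w i) ^t* *m (H *m x)) 0 0 = ((w i) ^t* *m H *m x) 0 0.
    by rewrite mulmxA.
  rewrite adjoint_eigen x_eigen -scalemxAl -scalemxAr [LHS]mxE [RHS]mxE => E.
  by rewrite mulrBl E subrr.
by rewrite mulf_eq0 subr_eq0 (negPf neq_a).
Qed.

Lemma eigenvalue_theta a : eigenvalue H a -> exists i, a = theta i.
Proof.
case/eigenvalueP => y y_eigen; rewrite [y]orthonormal_expand_row => y_neq0.
have /existsP[i /eqP ->] : [exists i, a == theta i]; last by exists i.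
apply: contraNT y_neq0 => /existsPn neq_a.
apply/eqP/big1 => i _.
by rewrite (eigen_row_orthogonal y_eigen (neq_a i)) scale0r.
Qed.

(** Every eigenvalue is one of the [theta i], so [n] distinct eigenvalues
    leave no room for a repetition among the [theta i]. *)
Lemma distinct_theta : all_eigenvalues_distinct H -> injective theta.
Proof.
case=> t [t_inj t_eig].
have /choice[s sE] : forall i, exists j, t i = theta j.
  by move=> i; apply: eigenvalue_theta.
have s_inj : injective s by move=> i j eq_s; apply: t_inj; rewrite !sE eq_s.
have [s' s'K sK'] := injF_bij s_inj.
by move=> i j; rewrite -(sK' i) -(sK' j) -2!sE => /t_inj->.
Qed.

Hypothesis theta_inj : injective theta.

Lemma eigenvector_multiple (x : 'cV[C]_n) i :
  H *m x = theta i *: x -> x = ((w i) ^t* *m x) 0 0 *: w i.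
Proof.
move=> x_eigen; rewrite {1}[x]orthonormal_expand (bigD1 i) //= big1 ?addr0 //.
move=> j neq_ji; rewrite (eigen_col_orthogonal x_eigen) ?scale0r //.
by rewrite (inj_eq theta_inj) eq_sym.
Qed.

Lemma left_eigenvector_multiple (y : 'rV[C]_n) i :
  y *m H = theta i *: y -> y = (y *m w i) 0 0 *: (w i) ^t*.
Proof.
move=> y_eigen.
rewrite {1}[y]orthonormal_expand_row (bigD1 i) //= big1 ?addr0 //.
move=> j neq_ji; rewrite (eigen_row_orthogonal y_eigen) ?scale0r //.
by rewrite (inj_eq theta_inj) eq_sym.
Qed.
End Orthonormal.
(** * Cospectrality *)

Section Extension.
Variables (C : numClosedFieldType) (n : nat) (K : {set 'I_n}).
Implicit Types (w : 'cV[C]_#|K|) (x : 'cV[C]_n).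

Lemma extend0K w : restrictK K (extend0 w) = w.
Proof.
apply/matrixP => i j; rewrite !mxE (ord1 j) (big_pred1 i) // => k /=.
exact: (inj_eq enum_val_inj).
Qed.

Lemma extend0Z a w : extend0 (a *: w) = a *: extend0 w.
Proof.
apply/matrixP => i j; rewrite !mxE mulr_sumr.
by apply: eq_bigr => k _; rewrite mxE.
Qed.

Lemma mul_diagK x : diagK K *m x = extend0 (restrictK K x).
Proof.
apply/matrixP => i j; rewrite (ord1 j) mul_diag_mx !mxE.
under eq_bigr => k /eqP ik do rewrite mxE ik.
have [iK | iK] := boolP (i \in K); last first.
  rewrite mul0r big1 // => k /eqP ki.
  by case/negP: iK; rewrite -ki; apply: enum_valP.
rewrite mul1r (big_pred1 (enum_rank_in iK i)) // => k /=.
by rewrite -{1}(enum_rankK_in iK iK) (inj_eq enum_val_inj).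
Qed.

Lemma adjoint_extend0 w x : (extend0 w) ^t* *m x = w ^t* *m restrictK K x.
Proof.
apply/matrixP => i j; rewrite (ord1 i) (ord1 j) !mxE.
under eq_bigr => k _ do rewrite !mxE rmorph_sum mulr_suml.
rewrite (exchange_big_dep predT) //=; apply: eq_bigr => l _.
by rewrite !mxE (big_pred1 (enum_val l)) // => k; rewrite /= eq_sym.
Qed.
End Extension.

Lemma adjoint_mul_conj (C : numClosedFieldType) n (x y : 'cV[C]_n) :
  (x ^t* *m y) 0 0 = ((y ^t* *m x) 0 0)^*.
Proof.
rewrite !mxE rmorph_sum; apply: eq_bigr => i _.
by rewrite !mxE rmorphM /= conjCK mulrC.
Qed.

Lemma left_eigen_mx_poly_apply (C : numClosedFieldType) n (A : 'M[C]_n)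
    (y : 'rV[C]_n) u a q :
  y *m A = a *: y -> y *m u = 0 -> y *m mx_poly_apply A q u = 0.
Proof.
move=> y_eigen yu0; elim/poly_ind: q => [|q c IHq].
  by rewrite mx_poly_apply0 mulmx0.
rewrite mx_poly_applyD mx_poly_applyMX mx_poly_applyC mulmxDr mulmxA y_eigen.
by rewrite -scalemxAl IHq -scalemxAr yu0 !scaler0 addr0.
Qed.

(** Expand q(M) u in the basis [psi] that witnesses cospectrality. A [psi i]
    orthogonal to [u] is orthogonal to q(M) u as well. For any other [psi i],
    the restriction to [K] is an eigenvector of [H] that is not orthogonal to
    [v j], and simplicity of the spectrum of [H] makes it a multiple of [v j];
    here [u] is [extend0 (v j)]. *)
Lemma cospectral_rank1 (C : numClosedFieldType) n (K : {set 'I_n})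
    (H : 'M[C]_#|K|) (M : 'M[C]_n) (v : 'I_#|K| -> 'cV[C]_#|K|) theta j q :
    cospectral H M -> orthonormal_basis v ->
    (forall i, H *m v i = theta i *: v i) -> injective theta ->
  diagK K *m mx_poly_apply M q (extend0 (v j)) =
    moment_form ((extend0 (v j)) ^t*) M (extend0 (v j)) q *: extend0 (v j).
Proof.
move=> [psi [psi_orth psi_eigen psi_K]] v_orth v_eigen theta_inj.
have /choice[lambda lambdaE] : forall i, exists a, M *m psi i = a *: psi i.
  by move=> i; case: (psi_eigen i) => _.
set u := extend0 (v j).
have D_psi i : (psi i) ^t* *m u != 0 ->
    diagK K *m psi i = (u ^t* *m psi i) 0 0 *: u.
  move=> psi_u; have u_psi : (u ^t* *m psi i) 0 0 != 0.
    apply: contraNneq psi_u => u_psi0; apply/eqP/matrixP => k l.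
    by rewrite (ord1 k) (ord1 l) [RHS]mxE adjoint_mul_conj u_psi0 rmorph0.
  rewrite mul_diagK {1}/u adjoint_extend0 -extend0Z.
  rewrite /u adjoint_extend0 in u_psi.
  case: (psi_K i) => [r0 | [_ [a x_eigen]]].
    by rewrite r0 mulmx0 mxE eqxx in u_psi.
  have [a_theta | neq_a] := eqVneq a (theta j).
    congr extend0; apply: (eigenvector_multiple v_orth v_eigen theta_inj).
    by rewrite x_eigen a_theta.
  by rewrite (eigen_col_orthogonal v_orth v_eigen x_eigen neq_a) eqxx in u_psi.
rewrite moment_formE; set x := mx_poly_apply M q u.
rewrite [x](orthonormal_expand psi_orth) !mulmx_sumr summxE scaler_suml.
apply: eq_bigr => i _; rewrite -!scalemxAr [X in _ = X *: _]mxE -scalerA.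
have [psi_u0 | psi_u] := eqVneq ((psi i) ^t* *m u) 0; last by rewrite D_psi.
have psi_left := adjoint_eigen psi_orth lambdaE i.
by rewrite /x (left_eigen_mx_poly_apply _ psi_left psi_u0) mxE !scale0r.
Qed.

(** * Descent to the coefficient field *)

Section Rationality.
Variables (F : fieldType) (C : numClosedFieldType) (iota : {rmorphism F -> C}).

Lemma row_eigenvector_descent k (H : 'M[F]_k) t (y : 'rV[C]_k) :
    y != 0 -> y *m map_mx iota H = iota t *: y ->
  exists2 yF : 'rV[F]_k, yF != 0 & yF *m H = t *: yF.
Proof.
move=> y_neq0 y_eigen; suff /eigenvalueP[yF] : eigenvalue H t by exists yF.
by rewrite -(eigenvalue_map iota); apply/eigenvalueP; exists y.
Qed.

Lemma eval_inner_pencil (Q : C) (mu nu : {poly F}) :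
  eval_inner iota Q (pencil mu nu) = map_poly iota mu - Q *: map_poly iota nu.
Proof.
apply/polyP => i; rewrite coef_map_id0; last by rewrite rmorph0 horner0.
rewrite coefB coefCM !coef_map /= coefB coefZ !coef_map /=.
by rewrite rmorphB rmorphM /= map_polyX !map_polyC !hornerE.
Qed.

Variables (n : nat) (K : {set 'I_n}) (M : 'M[F]_n) (H : 'M[F]_#|K|).
Variables (v : 'I_#|K| -> 'cV[C]_#|K|) (theta : 'I_#|K| -> F).
Hypothesis v_orth : orthonormal_basis v.
Hypothesis v_eigen : forall i, map_mx iota H *m v i = iota (theta i) *: v i.
Hypothesis theta_inj : injective theta.

Let iota_theta_inj : injective (iota \o theta).
Proof. exact: inj_comp (fmorph_inj iota) theta_inj. Qed.

(** The eigenspace is defined over the small field, and it is a line. *)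
Lemma eigenvector_rational j :
  exists2 c, c != 0 & exists w : 'cV[F]_#|K|, c *: v j = map_mx iota w.
Proof.
have [||w w_neq0 w_eigen] := @row_eigenvector_descent _ (H^T) (theta j) (v j)^T.
- by rewrite trmx_eq0 (orthonormal_neq0 v_orth).
- by rewrite -map_trmx -trmx_mul v_eigen linearZ.
have Hw : map_mx iota H *m map_mx iota w^T = iota (theta j) *: map_mx iota w^T.
  by rewrite -map_mxM -[H]trmxK -trmx_mul w_eigen linearZ /= map_mxZ.
have wE := eigenvector_multiple v_orth v_eigen iota_theta_inj Hw.
exists (((v j) ^t* *m map_mx iota w^T) 0 0); last by exists w^T.
apply: contraNneq w_neq0 => c0; rewrite -trmx_eq0 -(map_mx_eq0 iota).
by rewrite wE c0 scale0r.
Qed.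

Lemma adjoint_eigenvector_rational j :
  exists2 c, c != 0 & exists y : 'rV[F]_#|K|, c *: (v j) ^t* = map_mx iota y.
Proof.
have [||y y_neq0 y_eigen] := @row_eigenvector_descent _ H (theta j) ((v j) ^t*).
- by rewrite map_mx_eq0 trmx_eq0 (orthonormal_neq0 v_orth).
- exact: (adjoint_eigen v_orth v_eigen).
have Hy : map_mx iota y *m map_mx iota H = iota (theta j) *: map_mx iota y.
  by rewrite -map_mxM y_eigen map_mxZ.
have yE := left_eigenvector_multiple v_orth v_eigen iota_theta_inj Hy.
exists ((map_mx iota y *m v j) 0 0); last by exists y.
apply: contraNneq y_neq0 => c0; rewrite -(map_mx_eq0 iota).
by rewrite yE c0 scale0r.
Qed.

(** The two scalars are inverse to each other so that, with the vectors [y] and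
    [w] over the small field, y q(M) w equals u^* q(M) u. The adjoint needs an
    argument of its own, as complex conjugation may move the small field:
    [adjoint_eigenvector_rational] uses that it is a left eigenvector of [H]. *)
Lemma extension_rational j :
  exists2 c, c != 0 &
    exists (w : 'cV[F]_n) (y : 'rV[F]_n),
      c *: extend0 (v j) = map_mx iota w /\
      c^-1 *: (extend0 (v j)) ^t* = map_mx iota y.
Proof.
have [c c_neq0 [w wE]] := eigenvector_rational j.
have [e e_neq0 [y yE]] := adjoint_eigenvector_rational j.
have ceE : iota ((y *m w) 0 0) = e * c.
  transitivity ((map_mx iota (y *m w)) 0 0); first by rewrite [RHS]mxE.
  rewrite map_mxM -wE -yE -scalemxAl -scalemxAr !mxE.
  by move: (v_orth j j); rewrite mxE eqxx => ->; rewrite mulr1.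
exists c => //.
exists (\col_x \sum_(i < #|K| | enum_val i == x) w i 0).
exists (((y *m w) 0 0)^-1 *: \row_x \sum_(i < #|K| | enum_val i == x) y 0 i).
split.
  rewrite -extend0Z wE; apply/matrixP => x i; rewrite !mxE rmorph_sum.
  by apply: eq_bigr => k _; rewrite mxE.
rewrite map_mxZ fmorphV ceE; apply/matrixP => i x; rewrite !mxE.
rewrite !rmorph_sum !mulr_sumr; apply: eq_bigr => k _.
have -> : iota (y 0 k) = e * (v j k 0)^*.
  by have /matrixP/(_ 0 k) := yE; rewrite !mxE.
by rewrite invfM mulrACA mulVf // mul1r.
Qed.

(** The polynomial [P] is [pencil mu nu] over the small field, where [mu] is the
    minimal polynomial relative to the same vector before the update and [nu]
    its difference quotient; the first descends as a minimal polynomial, the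
    second because its functional takes values in the small field. *)
Lemma minpoly_update_irreducible (Q : C) j p :
    (map_mx iota M) ^t* = map_mx iota M ->
    cospectral (map_mx iota H) (map_mx iota M) ->
    relative_minpoly (map_mx iota M + Q *: diagK K) (extend0 (v j)) p ->
  exists P : {poly {poly F}},
    [/\ eval_inner iota Q P = p, irreducible_elem P
      & irreducible_poly (map_poly (@tofrac {poly F}) P)].
Proof.
move=> M_herm cosp; set u := extend0 (v j).
have u_neq0 : u != 0.
  apply: contraNneq (orthonormal_neq0 v_orth j) => u0.
  by rewrite -[v j]extend0K -/u u0; apply/eqP/matrixP => i k; rewrite !mxE.
have rank1 q := cospectral_rank1 j q cosp v_orth v_eigen iota_theta_inj.
case/(relative_minpoly_update rank1); rewrite -/u => mu mu_min pE.
have [c c_neq0 [w [y [wE yE]]]] := extension_rational j.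
have [muF muF_monic muE] : exists2 muF, muF \is monic & mu = map_poly iota muF.
  apply: (relative_minpoly_descent (A := M) (w := w)); rewrite -wE.
  apply: (@relative_minpolyZ _ _ _ _ c^-1); first by rewrite invr_eq0.
  by rewrite scalerA mulVf ?scale1r.
pose LF : {scalar {poly F}} := moment_form y M w.
pose nuF := diffquo LF muF.
have nuE :
    map_poly iota nuF = diffquo (moment_form (u ^t*) (map_mx iota M) u) mu.
  rewrite muE; apply: map_diffquo => q.
  rewrite [RHS]map_moment_form !moment_formE -wE -yE.
  rewrite mx_poly_apply_scale -scalemxAl -scalemxAr scalerA mulVf ?scale1r //.
  exact: moment_formE.
have muF_gt1 : (1 < size muF)%N.
  by rewrite -(size_map_poly iota) -muE (relative_minpoly_gt1 u_neq0 mu_min).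
have nuF_lt : (size nuF < size muF)%N.
  by apply: size_diffquo_lt; apply: monic_neq0.
have co_mu_nu : coprimep muF nuF.
  by rewrite -(coprimep_map iota) nuE -muE (coprimep_diffquo M_herm).
have irr := pencil_irreducible_frac muF_gt1 nuF_lt co_mu_nu.
exists (pencil muF nuF); split=> //.
  by rewrite eval_inner_pencil nuE -muE.
apply: monic_irreducible_frac irr.
by rewrite monicE lead_coef_pencil // (monicP muF_monic).
Qed.
End Rationality.
Section CoefficientField.
Variables (R : realType) (n k : nat) (M : 'M[R]_n) (H : 'M[R[i]%C]_k).
Local Notation incl := (@coef_incl R n k M H).

Lemma coef_subfieldP (z : R[i]%C) :
  reflect (exists x, incl x = z) (z \in coef_subfield M H).
Proof.
apply: (iffP idP) => [zF | [x <-]]; last exact: (valP x).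
by exists (exist _ z zF).
Qed.

Lemma coef_gens_sub z : coef_gens M H z -> z \in coef_subfield M H.
Proof. by move=> z_gen; apply/asboolP => S _; apply. Qed.

Lemma mxOver_coef_subfield p q (A : 'M[R[i]%C]_(p, q)) :
  A \is a mxOver (coef_subfield M H) <-> exists B, map_mx incl B = A.
Proof.
split=> [/mxOverP A_over | [B <-]]; last first.
  by apply/mxOverP => i j; rewrite mxE; apply/coef_subfieldP; exists (B i j).
have /choice[B BE] : forall ij, exists x, incl x = A ij.1 ij.2.
  by move=> ij; apply/coef_subfieldP.
by exists (\matrix_(i, j) B (i, j)); apply/matrixP => i j; rewrite !mxE BE.
Qed.
End CoefficientField.

Lemma complexify_hermitian (R : realType) n (M : 'M[R]_n) :
  M^T = M -> map_mx Num.Def.conjC (complexify M)^T = complexify M.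
Proof.
move=> M_sym; rewrite /complexify map_trmx M_sym; apply/matrixP => i j.
by rewrite !mxE; apply/CrealP; rewrite complex_real.
Qed.

Theorem theorem3p13 (R : realType) (n : nat) (K : {set 'I_n})
    (M : 'M[R]_n) (H : 'M[R[i]%C]_#|K|)
    (v : 'I_#|K| -> 'cV[R[i]%C]_#|K|)
    (Q : R) (P : 'I_#|K| -> {poly R[i]%C})
    (M_sym : M^T = M)
    (H_normal : H \is normalmx)
    (H_distinct : all_eigenvalues_distinct H)
    (v_orthonormal : orthonormal_basis v)
    (v_eigen : forall j, eigenvector H (v j))
    (K_cospectral : cospectral H (complexify M))
    (H_over : H \is a mxOver (coef_subfield M H))
    (Q_indep : ~ algebraicOver (@coef_incl R n #|K| M H) (real_complex R Q))
    (P_minpoly : forall j,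
      relative_minpoly (complexify M + real_complex R Q *: diagK K)
        (extend0 (v j)) (P j)) :
  (forall j, exists2 c : R[i]%C, c != 0 &
     c *: v j \is a mxOver (coef_subfield M H)) /\
  (forall j, exists p : {poly {poly coef_field M H}},
     [/\ eval_inner (@coef_incl R n #|K| M H) (real_complex R Q) p = P j,
         irreducible_elem p
       & irreducible_poly
           (map_poly (@tofrac {poly coef_field M H}) p)]).
Proof.
pose incl : {rmorphism coef_field M H -> R[i]%C} := @coef_incl R n #|K| M H.
have [MF MFE] : exists MF, map_mx incl MF = complexify M.
  apply/mxOver_coef_subfield/mxOverP => i j.
  by apply: coef_gens_sub; left; exists i, j.
have /mxOver_coef_subfield[HF HFE] := H_over.
have /choice[lambda lambdaE] : forall i, exists a, H *m v i = a *: v i.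
  by move=> i; case: (v_eigen i).
(* The adjoints of the v i are left eigenvectors, so each eigenvalue is a root
   of the characteristic polynomial. *)
have /choice[theta thetaL] : forall i, exists t, incl t = lambda i.
  move=> i; apply/coef_subfieldP/coef_gens_sub; right.
  rewrite -eigenvalue_root_char; apply/eigenvalueP.
  exists (map_mx Num.Def.conjC (v i)^T).
    exact: (adjoint_eigen v_orthonormal lambdaE).
  by rewrite map_mx_eq0 trmx_eq0 (orthonormal_neq0 v_orthonormal).
have thetaE i : H *m v i = incl (theta i) *: v i by rewrite thetaL.
have theta_inj : injective theta.
  exact: inj_compr (distinct_theta v_orthonormal thetaE H_distinct).
have thetaFE i : map_mx incl HF *m v i = incl (theta i) *: v i by rewrite HFE.
have cospF : cospectral (map_mx incl HF) (map_mx incl MF) by rewrite HFE MFE.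
split=> j.
  have [c c_neq0 [w wE]] :=
    eigenvector_rational v_orthonormal thetaFE theta_inj j.
  by exists c => //; apply/mxOver_coef_subfield; exists w; rewrite wE.
have MF_herm : map_mx Num.Def.conjC (map_mx incl MF)^T = map_mx incl MF.
  by rewrite MFE complexify_hermitian.
have minP : relative_minpoly (map_mx incl MF + real_complex R Q *: diagK K)
  (extend0 (v j)) (P j) by rewrite MFE.
exact: (minpoly_update_irreducible v_orthonormal thetaFE theta_inj MF_herm
  cospF minP).
Qed.
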